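(* Let $U:\mathcal{T}\times\mathbb{R}^r\to\mathbb{R}$ satisfy A1 and A2 with constants $0<\alpha\le\beta_U$, let $\phi^*(t)=\arg\max_{r}U(t,r)$, and let $t\sim F$. For any category assignment $c:\mathcal{T}\to\{1,\dots,K\}$ with category allocation $\phi(k)=\mathbb{E}[\phi^*(t)\mid c(t)=k]$ and within-category variance $\varepsilon=\mathbb{E}\bigl[\|\phi^*(t)-\phi(c(t))\|^2\bigr]$, $$\frac{\alpha}{2}\,\varepsilon\;\le\;\mathbb{E}\bigl[U(t,\phi^*(t))-U(t,\phi(c(t)))\bigr]\;\le\;\frac{\beta_U}{2}\,\varepsilon .$$
   Context: Types $t$ take values in $\mathcal{T}\subseteq\mathbb{R}^d$ with distribution $F$; all expectations are over $t\sim F$. The utility $U(t,r)$ is measurable and twice continuously differentiable in $r\in\mathbb{R}^r$ (here $\mathbb{R}^r$ is a finite-dimensional Euclidean space, the unconstrained action space). Assumptions: A1 ($\beta_U$-smoothness): $\nabla^2_{rr}U(t,r)\succeq-\beta_U I$ for all $(t,r)$, with $\beta_U>0$. A2 ($\alpha$-strong concavity): $\nabla^2_{rr}U(t,r)\preceq-\alpha I$ for all $(t,r)$, with $0<\alpha\le\beta_U$. Since the action space is unconstrained, the maximiser $\phi^*(t)$ is interior and $\nabla_rU(t,\phi^*(t))=0$. A category assignment is a measurable map $c:\mathcal{T}\to\{1,\dots,K\}$. The map $\phi^*$ is measurable and integrable so that the conditional means exist (the value of $\phi(k)$ on a category of probability zero is irrelevant). Expectations of nonnegative quantities are allowed to be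 $+\infty$. *)

(* Defs.v *)
From HB Require Import structures.
From mathcomp Require Export all_boot all_order all_algebra.
From mathcomp Require Export all_classical all_reals all_analysis.

Set Implicit Arguments.
Unset Strict Implicit.
Unset Printing Implicit Defensive.

Export Order.TTheory GRing.Theory Num.Theory.
Export numFieldNormedType.Exports.

#[global] Open Scope classical_set_scope.
#[global] Open Scope ring_scope.

(* The Euclidean space R^n with its Borel sigma-algebra (the library has no
   measurable structure on matrices). Convertible to 'rV[R]_n. *)
Notation borel_rV R n := (g_sigma_algebraType (@open 'rV[R]_n)).

(* The library norm on 'rV[R]_n is the sup norm. *)
Definition enorm (R : realType) (n : nat) (v : 'rV[R]_n) : R :=
  Num.sqrt (\sum_(i < n) v 0 i ^+ 2).

Definition gradient (R : realType) (n : nat) (f : 'rV[R]_n -> R)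
    (x : 'rV[R]_n) : 'rV[R]_n :=
  \row_(i < n) 'D_(delta_mx 0 i) f x.

Definition hessian (R : realType) (n : nat) (f : 'rV[R]_n -> R)
    (x : 'rV[R]_n) : 'M[R]_n :=
  'J (gradient f) x.

Definition twice_continuously_differentiable (R : realType) (n : nat)
    (f : 'rV[R]_n -> R) : Prop :=
  [/\ forall x, differentiable f x,
      forall x, differentiable (gradient f) x &
      continuous (hessian f)].

(* Symmetry is not required: Hessians of C^2 functions are symmetric. *)
Definition loewner_le (R : realType) (n : nat) (A B : 'M[R]_n) : Prop :=
  forall v : 'rV[R]_n, 0 <= (v *m (B - A) *m v^T) 0 0.

Definition is_argmax (R : realType) (n : nat) (f : 'rV[R]_n -> R)
    (x : 'rV[R]_n) : Prop :=
  forall y, f y <= f x.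

(* {1, ..., K} is 'I_K with the discrete sigma-algebra; this is measurable_fun
   unfolded for that codomain ('I_K is not a measurableType: those are pointed,
   hence nonempty). *)
Definition measurable_assignment (R : realType) (d K : nat)
    (T : set (borel_rV R d)) (c : borel_rV R d -> 'I_K) : Prop :=
  forall B : set 'I_K, measurable (T `&` c @^-1` B).

Section categories.
Context (R : realType) (d r K : nat).
Variables (F : probability (borel_rV R d) R) (T : set (borel_rV R d)).
Variables (phistar : borel_rV R d -> 'rV[R]_r) (c : borel_rV R d -> 'I_K).

Definition category (k : 'I_K) : set (borel_rV R d) := T `&` c @^-1` [set k].

Definition conditional_mean (k : 'I_K) : 'rV[R]_r :=
  \row_(i < r) ((\int[F]_(t in category k) (phistar t 0 i)) / fine (F (category k))).

(* Arbitrary on categories of probability zero. *)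
Definition is_category_allocation (phi : 'I_K -> 'rV[R]_r) : Prop :=
  forall k, F (category k) != 0%E -> phi k = conditional_mean k.

Definition within_category_variance (phi : 'I_K -> 'rV[R]_r) : \bar R :=
  (\int[F]_(t in T) (enorm (phistar t - phi (c t)) ^+ 2)%:E)%E.

End categories.

(* Main.v *)
Require Import Defs.
From mathcomp Require Import measurable_realfun ring lra.

(* Fix t and restrict U t to the segment from phistar t to phi (c t). The
   derivative of the restriction vanishes at phistar t and its second derivative
   lies between -betaU * |v|^2 and -alpha * |v|^2, with v the difference of the
   endpoints; integrating twice sandwiches the pointwise loss between multiples
   of |v|^2, and both inequalities follow by monotonicity of the integral. *)

(** For every [h], the difference quotient of the restriction at [s] is that of [f] at [x + s *: v]
    along [v], so derivability and the value of the derivative transfer together. *)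
Lemma is_derive_line (R : realType) (V W : normedModType R) (f : V -> W)
    (x v : V) (s : R) (l : W) :
  is_derive (x + s *: v) v f l -> is_derive s 1 (fun s => f (x + s *: v)) l.
Proof.
have E : (fun h : R => h^-1 *: (((fun s => f (x + s *: v)) \o shift s) (h *: 1)
                                - f (x + s *: v))) =
         (fun h => h^-1 *: ((f \o shift (x + s *: v)) (h *: v)
                            - f (x + s *: v))).
  by apply/funext => h /=; rewrite [h *: 1]mulr1 scalerDl addrCA.
by case=> df <-; split; rewrite /derivable /derive E.
Qed.

Lemma is_derive_gradient (R : realType) (n : nat) (f : 'rV[R]_n -> R)
    (x v : 'rV[R]_n) :
  differentiable f x -> is_derive x v f (\sum_i v 0 i * gradient f x 0 i).
Proof.
move=> df; split; first exact: diff_derivable.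
rewrite deriveE // {1}(row_sum_delta v) linear_sum; apply: eq_bigr => i _.
by rewrite linearZ mxE deriveE.
Qed.

(** The Jacobian acts on row vectors from the right, so the [i]-th partial derivative changes along
    [v] at rate [(v *m hessian f x) 0 i]; weighting these rates by [v 0 i] gives the quadratic
    form. *)
Lemma is_derive_hessian (R : realType) (n : nat) (f : 'rV[R]_n -> R)
    (x v : 'rV[R]_n) :
  differentiable (gradient f) x ->
  is_derive x v (fun y => \sum_i v 0 i * gradient f y 0 i)
            ((v *m hessian f x *m v^T) 0 0).
Proof.
move=> df.
have dg i : is_derive x v (fun y => gradient f y 0 i) ((v *m hessian f x) 0 i).
  have dv := @diff_derivable _ _ _ _ _ v df.
  split; first exact: (iffLR (derivable_mxP _ _ _) dv).
  by rewrite /hessian /jacobian mul_rV_lin1 -deriveE // derive_mx // mxE.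
have -> : (fun y => \sum_i v 0 i * gradient f y 0 i) =
          \sum_i v 0 i *: (fun y => gradient f y 0 i).
  by apply/funext => y; rewrite fct_sumE.
have -> : (v *m hessian f x *m v^T) 0 0 = \sum_i v 0 i *: (v *m hessian f x) 0 i.
  by rewrite mxE; apply: eq_bigr => i _; rewrite [v^T _ _]mxE mulrC.
by apply: is_derive_sum => i; exact: is_deriveZ.
Qed.

Lemma MVT_is_derive {R : realType} {g dg : R -> R} {a b : R} : a < b ->
  (forall s : R, is_derive s 1 g (dg s)) ->
  exists2 c, c \in `]a, b[ & g b - g a = dg c * (b - a).
Proof.
move=> ab dgP; apply: MVT => //.
apply: continuous_subspaceT => s.
by apply/differentiable_continuous/derivable1_diffP; case: (dgP s).
Qed.

(** Subtract the parabola with second derivative [a]: the mean value theorem for [h] on [[0, 1]]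
    yields [c], and for [dg] on [[0, c]] it yields [dg c <= a * c], so [h 1 <= h 0]. Only the upper
    estimate is stated; a lower one follows by negating [g]. *)
Lemma le_taylor2 {R : realType} {g dg ddg : R -> R} {a : R} :
  (forall s : R, is_derive s 1 g (dg s)) ->
  (forall s : R, is_derive s 1 dg (ddg s)) ->
  dg 0 = 0 -> (forall s, ddg s <= a) -> g 1 <= g 0 + a / 2.
Proof.
move=> dgP ddgP dg0 ddg_le.
pose h s := g s - (a / 2) * s ^+ 2.
have dhP (s : R) : is_derive s 1 h (dg s - a * s).
  have -> : dg s - a * s = dg s - (a / 2) *: (2%:R * s).
    by rewrite /GRing.scale /=; field.
  have -> : h = g - (a / 2) *: (fun s => s ^+ 2) by [].
  apply: is_deriveB; apply: is_deriveZ.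
  have := is_deriveX 2 (is_derive_id s (1 : R)).
  by rewrite expr1 [_ *: _]mulr1.
have [c c01 hc] := MVT_is_derive (ltr01 : (0 : R) < 1) dhP.
have c_gt0 : 0 < c by move: c01; rewrite in_itv /= => /andP[].
have [e _ de] := MVT_is_derive c_gt0 ddgP.
have dgc : dg c <= a * c.
  by move: de; rewrite dg0 !subr0 => ->; rewrite ler_pM2r.
by move: hc; rewrite /h; lra.
Qed.

Lemma enorm_sqr (R : realType) (n : nat) (v : 'rV[R]_n) :
  enorm v ^+ 2 = \sum_i v 0 i ^+ 2.
Proof. by rewrite sqr_sqrtr // sumr_ge0 // => i _; rewrite sqr_ge0. Qed.

Lemma quadratic_formB (R : realType) (n : nat) (A B : 'M[R]_n) (v : 'rV[R]_n) :
  (v *m (A - B) *m v^T) 0 0 = (v *m A *m v^T) 0 0 - (v *m B *m v^T) 0 0.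
Proof. by rewrite mulmxBr mulmxBl [LHS]mxE [in X in _ + X = _]mxE. Qed.

Lemma scalar_quadratic_form (R : realType) (n : nat) (a : R) (v : 'rV[R]_n) :
  (v *m a%:M *m v^T) 0 0 = a * enorm v ^+ 2.
Proof.
rewrite mul_mx_scalar -scalemxAl mxE enorm_sqr mxE; congr (_ * _).
by apply: eq_bigr => i _; rewrite mxE.
Qed.

Lemma argmax_loss_bounds {R : realType} {n : nat} {f : 'rV[R]_n -> R}
    {a b : R} {x : 'rV[R]_n} (y : 'rV[R]_n) :
  twice_continuously_differentiable f ->
  (forall z, loewner_le ((- b)%:M) (hessian f z)) ->
  (forall z, loewner_le (hessian f z) ((- a)%:M)) ->
  is_argmax f x ->
  a / 2 * enorm (x - y) ^+ 2 <= f x - f y <= b / 2 * enorm (x - y) ^+ 2.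
Proof.
move=> [df dgf _] Hb Ha xmax.
pose v := y - x.
pose g (s : R) := f (x + s *: v).
pose dg (s : R) := \sum_i v 0 i * gradient f (x + s *: v) 0 i.
pose ddg (s : R) := (v *m hessian f (x + s *: v) *m v^T) 0 0.
have dgP (s : R) : is_derive s 1 g (dg s).
  exact/is_derive_line/is_derive_gradient/df.
have ddgP (s : R) : is_derive s 1 dg (ddg s).
  apply: (@is_derive_line _ _ _ (fun z => \sum_i v 0 i * gradient f z 0 i)).
  exact/is_derive_hessian/dgf.
(* Since [f] is maximal at [x] over the whole space, [g] has an interior maximum at [0] on []-1,
   1[]; Fermat's rule and uniqueness of the derivative conclude. *)
have dg0 : dg 0 = 0.
  have : is_derive (0 : R) 1 g 0.
    apply: (@derive1_at_max _ g (- 1) 1 0).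
    - by lra.
    - by move=> s _; case: (dgP s).
    - by rewrite in_itv /=; lra.
    - by move=> s _; rewrite /g scale0r addr0; exact: xmax.
  by case=> _; case: (dgP 0) => _ ->.
have g0 : g 0 = f x by rewrite /g scale0r addr0.
have g1 : g 1 = f y by rewrite /g scale1r addrC subrK.
have vE : enorm (x - y) ^+ 2 = enorm v ^+ 2.
  rewrite !enorm_sqr; apply: eq_bigr => i _.
  by rewrite -sqrrN /v !mxE opprB.
(* The matrix inequality at the point [x + s *: v] is tested on the direction [v] itself. *)
have ddg_le s : ddg s <= - a * enorm v ^+ 2.
  have := Ha (x + s *: v) v.
  by rewrite quadratic_formB scalar_quadratic_form subr_ge0.
have ddg_ge s : - ddg s <= b * enorm v ^+ 2.
  have := Hb (x + s *: v) v.
  by rewrite quadratic_formB scalar_quadratic_form subr_ge0 mulNr lerNl.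
have upper := le_taylor2 dgP ddgP dg0 ddg_le.
(* The same estimate for [- g], whose second derivative is at most [b * enorm v ^+ 2]. *)
have lower : - g 1 <= - g 0 + b * enorm v ^+ 2 / 2.
  apply: (@le_taylor2 _ (- g) (- dg) (- ddg)) => //.
  by rewrite fctE dg0 oppr0.
rewrite vE; move: upper lower; rewrite g0 g1 => upper lower.
by apply/andP; split; lra.
Qed.

(* Unlike the library's [ge0_le_integral], this needs no measurability: the
   integral of a nonnegative function is a supremum over simple minorants. *)
Lemma ge0_le_integral_pointwise (d : measure_display) (T : measurableType d)
    (R : realType) (mu : {measure set T -> \bar R}) (D : set T)
    (f g : T -> \bar R) :
  (forall x, D x -> 0 <= f x)%E -> (forall x, D x -> f x <= g x)%E ->
  (\int[mu]_(x in D) f x <= \int[mu]_(x in D) g x)%E.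
Proof.
move=> f0 fg.
have g0 x : D x -> (0 <= g x)%E by move=> Dx; exact: le_trans (f0 x Dx) (fg x Dx).
rewrite !ge0_integralE //; apply: le_ereal_sup => _ [h hf <-].
exists h => // x; apply: le_trans (hf x) _; rewrite /patch.
by case: ifPn => // /set_mem; exact: fg.
Qed.

(** The preimage of [B] is the preimage under [c] of a set of categories, and all of these are
    measurable. *)
Lemma measurable_fun_assignment {R : realType} {d K : nat}
    {T : set (borel_rV R d)} {c : borel_rV R d -> 'I_K} (u : 'I_K -> R) :
  measurable_assignment T c -> measurable_fun T (fun t => u (c t)).
Proof. by move=> mc _ B _; exact: (mc (u @^-1` B)). Qed.

(** Needed to move constants across the integral defining the variance. Each coordinate of [phistar]
    is measurable because it is integrable. *)
Lemma measurable_sqr_enorm_deviation {R : realType} {d r K : nat}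
    {F : probability (borel_rV R d) R} {T : set (borel_rV R d)}
    {phistar : borel_rV R d -> 'rV[R]_r} {c : borel_rV R d -> 'I_K}
    (phi : 'I_K -> 'rV[R]_r) :
  (forall i : 'I_r, F.-integrable T (fun t => (phistar t 0 i)%:E)) ->
  measurable_assignment T c ->
  measurable_fun T (fun t => enorm (phistar t - phi (c t)) ^+ 2).
Proof.
move=> iphistar mc.
under eq_fun do rewrite enorm_sqr.
apply: measurable_sum => i.
under eq_fun do rewrite !mxE.
apply: measurable_funX; apply: measurable_funB.
  by apply/measurable_EFinP; exact: measurable_int (iphistar i).
exact: (measurable_fun_assignment (fun k => phi k 0 i) mc).
Qed.

Theorem proposition1 (R : realType) (d r K : nat)
    (T : set (borel_rV R d)) (mT : measurable T)
    (F : probability (borel_rV R d) R) (FT : F T = 1%E)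
    (U : borel_rV R d -> 'rV[R]_r -> R)
    (mU : measurable_fun (T `*` [set: borel_rV R r])
            (fun z : borel_rV R d * borel_rV R r => U z.1 z.2))
    (U_C2 : forall t, T t -> twice_continuously_differentiable (U t))
    (alpha betaU : R) (alpha_gt0 : 0 < alpha) (alpha_le : alpha <= betaU)
    (A1 : forall t, T t -> forall x : 'rV[R]_r,
            loewner_le ((- betaU)%:M) (hessian (U t) x))
    (A2 : forall t, T t -> forall x : 'rV[R]_r,
            loewner_le (hessian (U t) x) ((- alpha)%:M))
    (phistar : borel_rV R d -> 'rV[R]_r)
    (phistar_argmax : forall t, T t -> is_argmax (U t) (phistar t))
    (mphistar : measurable_fun T (phistar : borel_rV R d -> borel_rV R r))
    (iphistar : forall i : 'I_r,
            F.-integrable T (fun t => (phistar t 0 i)%:E))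
    (c : borel_rV R d -> 'I_K) (mc : measurable_assignment T c)
    (phi : 'I_K -> 'rV[R]_r)
    (phi_mean : is_category_allocation F T phistar c phi) :
  let eps := within_category_variance F T phistar c phi in
  let loss := (\int[F]_(t in T) (U t (phistar t) - U t (phi (c t)))%:E)%E in
  ((alpha / 2)%:E * eps <= loss)%E /\ (loss <= (betaU / 2)%:E * eps)%E.
Proof.
move=> eps loss; have beta_gt0 := lt_le_trans alpha_gt0 alpha_le.
have bounds t (Tt : T t) := argmax_loss_bounds (phi (c t)) (U_C2 t Tt)
  (A1 t Tt) (A2 t Tt) (phistar_argmax t Tt).
have /measurable_EFinP mdev := measurable_sqr_enorm_deviation phi iphistar mc.
(* The integrand is nonnegative, so this identity in the extended reals also covers an infinite
   [eps]. *)
have scaleE a : 0 < a -> ((a / 2)%:E * eps =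
    \int[F]_(t in T) (a / 2 * enorm (phistar t - phi (c t)) ^+ 2)%:E)%E.
  move=> a_gt0; rewrite -ge0_integralZl_EFin //.
  - by move=> t _; rewrite lee_fin sqr_ge0.
  - by rewrite divr_ge0 // ltW.
(* Each half asks for nonnegativity of the smaller integrand and a pointwise comparison; the loss is
   nonnegative by maximality of [phistar t]. *)
rewrite !scaleE //; split; apply: ge0_le_integral_pointwise => t Tt.
- by rewrite lee_fin mulr_ge0 ?sqr_ge0 // divr_ge0 // ltW.
- by rewrite lee_fin; case/andP: (bounds t Tt).
- by rewrite lee_fin subr_ge0; exact: phistar_argmax.
- by rewrite lee_fin; case/andP: (bounds t Tt).
Qed.
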